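(* Let $k\ge2$ and consider the learned affine system under the controller $u(x)=Hx+W_{u\min}^{k+1}w^k+b_u^{k+1}$, i.e. the closed-loop system $$\dot x=(A+gH)x+W_{\min}w^k+b^{k+1}+gb_u^{k+1},\qquad W_{\min}=W^{k+1}+gW_{u\min}^{k+1},\quad W_{u\min}^{k+1}\in\underset{W_u^{k+1}}{\mathrm{argmin}}\,\|W^{k+1}+gW_u^{k+1}\|,$$ where $w^k=w^k(x)$ is the output of the $k$-th hidden layer of a feedforward network with $\tanh$ activation functions that are incrementally sector bounded by $[K_1^i,K_2^i]$, $i=1,\dots,k$, with nonnegative diagonal matrices $K_1^i\le K_2^i$, and $b_u^{k+1}\in\mathbb{R}^l$ is arbitrary. Suppose that, for a fixed positive constant $\underline{s}$, there exist a positive definite matrix $S\in\mathbb{R}^{n\times n}$, positive constants $\mu,\overline{s}$, and a matrix $Y\in\mathbb{R}^{l\times n}$ such that $\underline{s}I\le S\le\overline{s}I$ and $$\bar U_1^\top\begin{bmatrix}-\mu I&S&0\\S&(AS+gY)^\top+AS+gY&W_{\min}\\0&W_{\min}^\top&0\end{bmatrix}\bar U_1+\bar U_2^\top\begin{bmatrix}0&0&0\\0&\bar X&\tilde X\\0&\tilde X^\top&-2I\end{bmatrix}\bar U_2\le0,$$ where $$\bar X=\begin{bmatrix}-2\underline{s}\,\underline{\lambda}S&0\\0&-2Q_1^{a\top}Q_2^a\end{bmatrix},\qquad \tilde X=\begin{bmatrix}S(Q_1^1+Q_2^1)^\top&0\\0&(Q_1^a+Q_2^a)^\top\end{bmatrix},$$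 and $\underline{\lambda}$ is the minimum eigenvalue of $Q_1^{1\top}Q_2^1$. Let $H=YS^{-1}$ and let $\mathcal{C}\subseteq\mathcal{D}$ be a set on which the resulting closed-loop system is forward complete and forward invariant. Then the closed-loop system is contractive in $\mathcal{C}$.
   Context: Network. $n=m_0=m_{k+1}$, $A\in\mathbb{R}^{n\times n}$, $g\in\mathbb{R}^{n\times l}$. For input $x\in\mathbb{R}^n$: $w^0=x$, $w^{i+1}=\phi^{i+1}(W^{i+1}w^i+b^{i+1})$ for $i=0,\dots,k-1$, with $W^{i+1}\in\mathbb{R}^{m_{i+1}\times m_i}$, $b^{i+1}\in\mathbb{R}^{m_{i+1}}$ for $i=0,\dots,k$. Each $\phi^i:\mathbb{R}^{m_i}\to\mathbb{R}^{m_i}$ acts componentwise through scalar activation functions $\varphi^i_j=\tanh$, $j=1,\dots,m_i$. The uncontrolled learned model is $\dot x=Ax+W^{k+1}w^k+b^{k+1}$, with control entering as $gu(x)$. The minimization over $W_u^{k+1}\in\mathbb{R}^{l\times m_k}$ is with respect to an induced matrix norm. $\mathcal{D}\subseteq\mathbb{R}^n$ is a given set of states. Incremental sector bound $[K_1^i,K_2^i]$: $K_1^i=\mathrm{diag}(\alpha^i_1,\dots,\alpha^i_{m_i})$, $K_2^i=\mathrm{diag}(\beta^i_1,\dots,\beta^i_{m_i})$ with $\alpha^i_j\le\beta^i_j$, and $(\varphi^i_j(s)-\varphi^i_j(t)-\alpha^i_j(s-t))(\varphi^i_j(s)-\varphi^i_j(t)-\beta^i_j(s-t))\le0$ for all $s,t$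 in the set of values of the $j$-th component of $W^iw^{i-1}+b^i$ as the network input $x$ ranges over $\mathcal{D}$. Matrices. $Q_1^1=K_1^1W^1$, $Q_2^1=K_2^1W^1$, $Q_1^a=\mathrm{blockdiag}(K_1^2W^2,\dots,K_1^kW^k)$, $Q_2^a=\mathrm{blockdiag}(K_2^2W^2,\dots,K_2^kW^k)$; $a=\sum_{i=1}^{k-1}m_i$; $$\bar U_1=\begin{bmatrix}I_n&0_{n\times n}&0_{n\times a}&0_{n\times m_k}\\0_{n\times n}&I_n&0_{n\times a}&0_{n\times m_k}\\0_{m_k\times n}&0_{m_k\times n}&0_{m_k\times a}&I_{m_k}\end{bmatrix},\qquad \bar U_2=\begin{bmatrix}I_n&0_{n\times n}&0_{n\times a}&0_{n\times m_k}\\0_{n\times n}&I_n&0_{n\times a}&0_{n\times m_k}\\0_{a\times n}&0_{a\times n}&I_a&0_{a\times m_k}\\0_{a\times n}&0_{a\times n}&I_a&0_{a\times m_k}\\0_{m_k\times n}&0_{m_k\times n}&0_{m_k\times a}&I_{m_k}\end{bmatrix}.$$ Forward complete and forward invariant on $\mathcal{C}$: for any initial state in $\mathcal{C}$ the trajectory exists and remains in $\mathcal{C}$ for all $t\ge0$. Contractive in a forward invariant set $\mathcal{C}$: there exist $c>0$, $\rho>0$ such that any two solutions with initial conditions in $\mathcal{C}$ satisfy $\|x_1(t)-x_2(t)\|\le ce^{-\rho t}\|x_1(0)-x_2(0)\|$ for all $t\ge0$ ($\|\cdot\|$ a fixed norm on $\mathbb{R}^n$). For symmetric matrices, $B\le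 C$ means $B-C$ is negative semidefinite. *)

(* Defs.v *)
From HB Require Import structures.
From mathcomp Require Import all_boot all_order all_algebra.
From mathcomp Require Import all_classical all_reals all_analysis.

Set Implicit Arguments.
Unset Strict Implicit.
Unset Printing Implicit Defensive.

Import Order.TTheory GRing.Theory Num.Theory.
Import numFieldNormedType.Exports.

Local Open Scope classical_set_scope.
Local Open Scope ring_scope.

Record is_norm (R : realType) (n : nat) (N : 'cV[R]_n -> R) : Prop := IsNorm {
  is_norm_triangle : forall x y, N (x + y) <= N x + N y ;
  is_norm_scale : forall (a : R) x, N (a *: x) = `|a| * N x ;
  is_norm_eq0 : forall x, N x = 0 -> x = 0 }.

(** Using [Nin x <= 1] rather than [Nin x = 1] gives the same supremum and also
    covers [q = 0]. *)
Definition induced_norm (R : realType) (p q : nat) (Nin : 'cV[R]_q -> R)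
    (Nout : 'cV[R]_p -> R) (M : 'M[R]_(p, q)) : R :=
  sup [set Nout (M *m x) | x in [set x | Nin x <= 1]].

Definition is_argmin (R : realType) (T : Type) (f : T -> R) (v : T) : Prop :=
  forall w, f v <= f w.

Definition qform (R : realType) (n : nat) (M : 'M[R]_n) (x : 'cV[R]_n) : R :=
  (x^T *m M *m x) 0 0.

Definition posdefmx (R : realType) (n : nat) (M : 'M[R]_n) : Prop :=
  M^T = M /\ forall x, x != 0 -> 0 < qform M x.

(** Symmetry is not required; both [negsemidefmx] and [mxle] are meant for
    symmetric matrices. *)
Definition negsemidefmx (R : realType) (n : nat) (M : 'M[R]_n) : Prop :=
  forall x, qform M x <= 0.

Definition mxle (R : realType) (n : nat) (B C : 'M[R]_n) : Prop :=
  negsemidefmx (B - C).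

Definition is_min_eigenvalue (R : realType) (n : nat) (M : 'M[R]_n) (a : R) :
    Prop :=
  eigenvalue M a /\ forall a', eigenvalue M a' -> a <= a'.

(** Feedforward networks.  The width of layer [i] is [m i], the input being
    layer [0].  [W i], [b i] and the sector bounds [alpha i], [beta i] lead from
    layer [i] to layer [i.+1]; they stand for what is usually written
    [W^(i+1)], [b^(i+1)], [K_1^(i+1)], [K_2^(i+1)].  A network with [k] hidden
    layers only uses the indices [i < k]. *)

Definition tanh (R : realType) (x : R) : R :=
  (expR x - expR (- x)) / (expR x + expR (- x)).

Fixpoint layer (R : realType) (m : nat -> nat)
    (W : forall i, 'M[R]_(m i.+1, m i)) (b : forall i, 'cV[R]_(m i.+1))
    (i : nat) (x : 'cV[R]_(m 0%N)) : 'cV[R]_(m i) :=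
  match i return 'cV[R]_(m i) with
  | 0 => x
  | i'.+1 => map_mx (@tanh R) (W i' *m layer W b i' x + b i')
  end.

Definition preact (R : realType) (m : nat -> nat)
    (W : forall i, 'M[R]_(m i.+1, m i)) (b : forall i, 'cV[R]_(m i.+1))
    (i : nat) (x : 'cV[R]_(m 0%N)) : 'cV[R]_(m i.+1) :=
  W i *m layer W b i x + b i.

Definition incr_sector (R : realType) (phi : R -> R) (I : set R) (a b : R) :
    Prop :=
  forall s t, I s -> I t ->
    (phi s - phi t - a * (s - t)) * (phi s - phi t - b * (s - t)) <= 0.

Definition network_incr_sector (R : realType) (m : nat -> nat)
    (W : forall i, 'M[R]_(m i.+1, m i)) (b : forall i, 'cV[R]_(m i.+1))
    (D : set 'cV[R]_(m 0%N)) (k : nat) (alpha beta : forall i, 'rV[R]_(m i.+1)) :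
    Prop :=
  forall i (j : 'I_(m i.+1)), (i < k)%N ->
    incr_sector (@tanh R) [set preact W b i x j 0 | x in D]
      (alpha i 0 j) (beta i 0 j).

Definition learned_affine_system (R : realType) (m : nat -> nat) (k l : nat)
    (A : 'M[R]_(m 0%N)) (g : 'M[R]_(m 0%N, l))
    (W : forall i, 'M[R]_(m i.+1, m i)) (b : forall i, 'cV[R]_(m i.+1))
    (Wout : 'M[R]_(m 0%N, m k)) (bout : 'cV[R]_(m 0%N))
    (u : 'cV[R]_(m 0%N) -> 'cV[R]_l) (x : 'cV[R]_(m 0%N)) : 'cV[R]_(m 0%N) :=
  A *m x + Wout *m layer W b k x + bout + g *m u x.

Definition nn_controller (R : realType) (m : nat -> nat) (k l : nat)
    (W : forall i, 'M[R]_(m i.+1, m i)) (b : forall i, 'cV[R]_(m i.+1))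
    (H : 'M[R]_(l, m 0%N)) (Wu : 'M[R]_(l, m k)) (bu : 'cV[R]_l)
    (x : 'cV[R]_(m 0%N)) : 'cV[R]_l :=
  H *m x + Wu *m layer W b k x + bu.

(** Solutions of [x' = f x] on [[0, +oo[], with the right derivative at [0];
    the values of [x] at negative times are irrelevant. *)
Definition is_solution (R : realType) (n : nat) (f : 'cV[R]_n -> 'cV[R]_n)
    (x : R -> 'cV[R]_n) : Prop :=
  (h^-1 *: (x h - x 0) @[h --> 0^'+] --> f (x 0)) /\
  (forall t : R, 0 < t -> is_derive t 1 x (f (x t))).

Definition forward_complete_invariant (R : realType) (n : nat)
    (f : 'cV[R]_n -> 'cV[R]_n) (C : set 'cV[R]_n) : Prop :=
  forall x0, C x0 ->
    (exists x, is_solution f x /\ x 0 = x0) /\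
    (forall x, is_solution f x -> x 0 = x0 -> forall t : R, 0 <= t -> C (x t)).

Definition contractive (R : realType) (n : nat) (N : 'cV[R]_n -> R)
    (f : 'cV[R]_n -> 'cV[R]_n) (C : set 'cV[R]_n) : Prop :=
  exists c rho : R, [/\ 0 < c, 0 < rho &
    forall x1 x2, is_solution f x1 -> is_solution f x2 -> C (x1 0) -> C (x2 0) ->
      forall t : R, 0 <= t ->
        N (x1 t - x2 t) <= c * expR (- rho * t) * N (x1 0 - x2 0)].

Definition row4 (R : realType) (p q1 q2 q3 q4 : nat)
    (B1 : 'M[R]_(p, q1)) (B2 : 'M[R]_(p, q2))
    (B3 : 'M[R]_(p, q3)) (B4 : 'M[R]_(p, q4)) :
    'M[R]_(p, q1 + (q2 + (q3 + q4))) :=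
  row_mx B1 (row_mx B2 (row_mx B3 B4)).

Definition block33 (R : realType) (p1 p2 p3 q1 q2 q3 : nat)
    (B11 : 'M[R]_(p1, q1)) (B12 : 'M[R]_(p1, q2)) (B13 : 'M[R]_(p1, q3))
    (B21 : 'M[R]_(p2, q1)) (B22 : 'M[R]_(p2, q2)) (B23 : 'M[R]_(p2, q3))
    (B31 : 'M[R]_(p3, q1)) (B32 : 'M[R]_(p3, q2)) (B33 : 'M[R]_(p3, q3)) :
    'M[R]_(p1 + (p2 + p3), q1 + (q2 + q3)) :=
  col_mx (row_mx B11 (row_mx B12 B13))
    (col_mx (row_mx B21 (row_mx B22 B23)) (row_mx B31 (row_mx B32 B33))).

(** The analogue of [mxdiag] for rectangular blocks; [conform_mx] only serves to
    identify the type of the block [(i, j)] with that of [(i, i)] when [i = j]. *)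
Definition blockdiag (R : realType) (s : nat) (p q : 'I_s -> nat)
    (B : forall i, 'M[R]_(p i, q i)) : 'M[R]_(\sum_i p i, \sum_i q i) :=
  \mxblock_(i, j) (if i == j then conform_mx (0 : 'M[R]_(p i, q j)) (B i) else 0).

(** [Q_1^(i+1)] for [K = alpha], [Q_2^(i+1)] for [K = beta]. *)
Definition Qlayer (R : realType) (m : nat -> nat)
    (K : forall i, 'rV[R]_(m i.+1)) (W : forall i, 'M[R]_(m i.+1, m i))
    (i : nat) : 'M[R]_(m i.+1, m i) :=
  diag_mx (K i) *m W i.

Definition adim (m : nat -> nat) (k : nat) : nat := (\sum_(i < k.-1) m i.+1)%N.

Definition Qa (R : realType) (m : nat -> nat) (k : nat)
    (K : forall i, 'rV[R]_(m i.+1)) (W : forall i, 'M[R]_(m i.+1, m i)) :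
    'M[R]_(\sum_(i < k.-1) m i.+2, adim m k) :=
  blockdiag (fun i : 'I_k.-1 => Qlayer K W i.+1).

Lemma hidden_dimE (m : nat -> nat) (k : nat) : (2 <= k)%N ->
  (m 1 + \sum_(i < k.-1) m i.+2 = adim m k + m k)%N.
Proof.
case: k => [//|[//|k]] _; rewrite /adim /=.
by rewrite big_ord_recr [X in _ = (X + _)%N]big_ord_recl /= addnA.
Qed.

Definition Ubar1 (R : realType) (m : nat -> nat) (k : nat) :
    'M[R]_(m 0%N + (m 0%N + m k), m 0%N + (m 0%N + (adim m k + m k))) :=
  col_mx (row4 1%:M 0 0 0)
 (col_mx (row4 0 1%:M 0 0)
         (row4 0 0 0 1%:M)).

(** The block rows are grouped as 1 + 2 + 2, which is how they are matched with
    the blocks of the matrix in the middle. *)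
Definition Ubar2 (R : realType) (m : nat -> nat) (k : nat) :
    'M[R]_(m 0%N + ((m 0%N + adim m k) + (adim m k + m k)),
           m 0%N + (m 0%N + (adim m k + m k))) :=
  col_mx (row4 1%:M 0 0 0)
 (col_mx (col_mx (row4 0 1%:M 0 0)
                 (row4 0 0 1%:M 0))
         (col_mx (row4 0 0 1%:M 0)
                 (row4 0 0 0 1%:M))).

Definition Xbar (R : realType) (m : nat -> nat) (k : nat) (slow lambda : R)
    (S : 'M[R]_(m 0%N)) (alpha beta : forall i, 'rV[R]_(m i.+1))
    (W : forall i, 'M[R]_(m i.+1, m i)) : 'M[R]_(m 0%N + adim m k) :=
  block_mx ((- 2 * slow * lambda) *: S) 0
           0 (- 2 *: ((Qa k alpha W)^T *m Qa k beta W)).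

(** The columns of this matrix are indexed by [m_1 + (m_2 + ... + m_k)] and those
    of the surrounding block by [(m_1 + ... + m_(k-1)) + m_k]; the cast identifies
    the two without moving any entry. *)
Definition Xtilde (R : realType) (m : nat -> nat) (k : nat) (hk : (2 <= k)%N)
    (S : 'M[R]_(m 0%N)) (alpha beta : forall i, 'rV[R]_(m i.+1))
    (W : forall i, 'M[R]_(m i.+1, m i)) :
    'M[R]_(m 0%N + adim m k, adim m k + m k) :=
  castmx (erefl, hidden_dimE m hk)
    (block_mx (S *m (Qlayer alpha W 0%N + Qlayer beta W 0%N)^T) 0
              0 (Qa k alpha W + Qa k beta W)^T).

(* Main.v *)
Require Import Defs.
From HB Require Import structures.
From mathcomp Require Import all_boot all_order all_algebra.
From mathcomp Require Import all_classical all_reals all_analysis.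
From mathcomp Require Import ring lra.

Set Implicit Arguments.
Unset Strict Implicit.
Unset Printing Implicit Defensive.

Import Order.TTheory GRing.Theory Num.Theory.
Import numFieldNormedType.Exports.

Local Open Scope classical_set_scope.
Local Open Scope ring_scope.

(** For two trajectories with difference [d], the function [V = d^T S^-1 d] is a
    Lyapunov function.  Evaluating the LMI at [mu^-1 d], [S^-1 d] and the
    differences of the layer outputs gives [V' + |d|^2 / mu] plus the sector
    expressions of the layers, the first of which has [d^T Q_1^T Q_2 d] replaced
    by the smaller quantity [slow * lambda * d^T S^-1 d].  The sector bounds have
    the right sign to be dropped, so that
    [V' <= - |d|^2 / mu <= - (slow / mu) V], and Gronwall's inequality together
    with the equivalence of norms on [R^n] concludes. *)

(** * Inner products, quadratic forms of block matrices, regrouping of stacked columns *)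

Section dot.
Variable R : realType.

Definition dot n (x y : 'cV[R]_n) : R := (x^T *m y) 0 0.

Lemma dotE n (x y : 'cV[R]_n) : dot x y = \sum_i x i 0 * y i 0.
Proof. by rewrite /dot mxE; apply: eq_bigr => i _; rewrite mxE. Qed.

Lemma dotC n (x y : 'cV[R]_n) : dot x y = dot y x.
Proof. by rewrite !dotE; apply: eq_bigr => i _; rewrite mulrC. Qed.

Lemma dotDr n (x y z : 'cV[R]_n) : dot x (y + z) = dot x y + dot x z.
Proof. by rewrite /dot mulmxDr mxE. Qed.

Lemma dotDl n (x y z : 'cV[R]_n) : dot (y + z) x = dot y x + dot z x.
Proof. by rewrite dotC dotDr !(dotC x). Qed.

Lemma dotZr n a (x y : 'cV[R]_n) : dot x (a *: y) = a * dot x y.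
Proof. by rewrite /dot -scalemxAr mxE. Qed.

Lemma dotZl n a (x y : 'cV[R]_n) : dot (a *: x) y = a * dot x y.
Proof. by rewrite dotC dotZr dotC. Qed.

Lemma dotNr n (x y : 'cV[R]_n) : dot x (- y) = - dot x y.
Proof. by rewrite -scaleN1r dotZr mulN1r. Qed.

Lemma dotNl n (x y : 'cV[R]_n) : dot (- x) y = - dot x y.
Proof. by rewrite dotC dotNr dotC. Qed.

Lemma dot0r n (x : 'cV[R]_n) : dot x 0 = 0.
Proof. by rewrite -[0](scale0r x) dotZr mul0r. Qed.

Lemma dot_col_mx p q (a c : 'cV[R]_p) (b d : 'cV[R]_q) :
  dot (col_mx a b) (col_mx c d) = dot a c + dot b d.
Proof. by rewrite /dot tr_col_mx mul_row_col mxE. Qed.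

Lemma dot_mulmxr p q (M : 'M[R]_(p, q)) x y :
  dot x (M *m y) = dot (M^T *m x) y.
Proof. by rewrite /dot trmx_mul trmxK mulmxA. Qed.

Lemma dot_mxcol s (p : 'I_s -> nat) (a c : forall i, 'cV[R]_(p i)) :
  dot (\mxcol_i a i) (\mxcol_i c i) = \sum_i dot (a i) (c i).
Proof. by rewrite /dot tr_mxcol mul_mxrow_mxcol summxE. Qed.

Lemma dot_ge0 n (x : 'cV[R]_n) : 0 <= dot x x.
Proof. by rewrite dotE sumr_ge0// => i _; rewrite -expr2 sqr_ge0. Qed.

Lemma dot_eq0 n (x : 'cV[R]_n) : (dot x x == 0) = (x == 0).
Proof.
apply/idP/eqP => [|->]; last by rewrite dot0r.
rewrite dotE psumr_eq0 => [/allP h|i _]; last by rewrite -expr2 sqr_ge0.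
apply/colP => i; rewrite mxE; apply/eqP.
by have := h i (mem_index_enum _); rewrite mulf_eq0 orbb.
Qed.

Lemma dot_gt0 n (x : 'cV[R]_n) : (0 < dot x x) = (x != 0).
Proof. by rewrite lt_neqAle dot_ge0 andbT eq_sym dot_eq0. Qed.

Lemma qformE n (M : 'M[R]_n) x : qform M x = dot x (M *m x).
Proof. by rewrite /qform /dot mulmxA. Qed.

Lemma qformD n (M M' : 'M[R]_n) x : qform (M + M') x = qform M x + qform M' x.
Proof. by rewrite !qformE mulmxDl dotDr. Qed.

Lemma qform_conj p q (U : 'M[R]_(p, q)) M x :
  qform (U^T *m M *m U) x = qform M (U *m x).
Proof. by rewrite !qformE -!mulmxA dot_mulmxr trmxK. Qed.

Lemma qform_block33 p1 p2 p3 (B11 : 'M[R]_(p1, p1)) (B12 : 'M[R]_(p1, p2))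
    (B13 : 'M[R]_(p1, p3)) (B21 : 'M[R]_(p2, p1)) (B22 : 'M[R]_(p2, p2))
    (B23 : 'M[R]_(p2, p3)) (B31 : 'M[R]_(p3, p1)) (B32 : 'M[R]_(p3, p2))
    (B33 : 'M[R]_(p3, p3)) x y z :
  qform (block33 B11 B12 B13 B21 B22 B23 B31 B32 B33)
        (col_mx x (col_mx y z)) =
  dot x (B11 *m x) + dot x (B12 *m y) + dot x (B13 *m z) +
  (dot y (B21 *m x) + dot y (B22 *m y) + dot y (B23 *m z)) +
  (dot z (B31 *m x) + dot z (B32 *m y) + dot z (B33 *m z)).
Proof.
rewrite qformE /block33 !mul_col_mx !mul_row_col !dot_col_mx !dotDr.
by rewrite !addrA.
Qed.

Lemma mulmx_row4_col p q1 q2 q3 q4 (B1 : 'M[R]_(p, q1)) (B2 : 'M[R]_(p, q2))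
    (B3 : 'M[R]_(p, q3)) (B4 : 'M[R]_(p, q4)) x1 x2 x3 (x4 : 'cV[R]_q4) :
  row4 B1 B2 B3 B4 *m col_mx x1 (col_mx x2 (col_mx x3 x4)) =
  B1 *m x1 + B2 *m x2 + B3 *m x3 + B4 *m x4.
Proof. by rewrite /row4 !mul_row_col !addrA. Qed.

Lemma mul_Ubar1 (m : nat -> nat) k (x1 x2 : 'cV[R]_(m 0%N))
    (x3 : 'cV[R]_(adim m k)) (x4 : 'cV[R]_(m k)) :
  Ubar1 R m k *m col_mx x1 (col_mx x2 (col_mx x3 x4)) =
  col_mx x1 (col_mx x2 x4).
Proof.
by rewrite /Ubar1 !mul_col_mx !mulmx_row4_col !(mul0mx, mul1mx, add0r, addr0).
Qed.

Lemma mul_Ubar2 (m : nat -> nat) k (x1 x2 : 'cV[R]_(m 0%N))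
    (x3 : 'cV[R]_(adim m k)) (x4 : 'cV[R]_(m k)) :
  Ubar2 R m k *m col_mx x1 (col_mx x2 (col_mx x3 x4)) =
  col_mx x1 (col_mx (col_mx x2 x3) (col_mx x3 x4)).
Proof.
by rewrite /Ubar2 !mul_col_mx !mulmx_row4_col !(mul0mx, mul1mx, add0r, addr0).
Qed.

Lemma mulmx_blockdiag_mxcol s (p q : 'I_s -> nat)
    (B : forall i, 'M[R]_(p i, q i)) (v : forall i, 'cV[R]_(q i)) :
  blockdiag B *m (\mxcol_i v i) = \mxcol_i (B i *m v i).
Proof.
rewrite /blockdiag mxblockEh mul_mxrow_mxcol.
rewrite (eq_bigr _ (fun j _ => mxcol_mul _ _)) -mxcol_sum; apply/eq_mxcolP => i.
rewrite (bigD1 i)//= eqxx conform_mx_id big1 ?addr0// => j ji.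
by rewrite eq_sym (negbTE ji) mul0mx.
Qed.

(* The casts relating different groupings of the same blocks do not change the
   sequence of entries of a column. *)
Definition colseq n (x : 'cV[R]_n) : seq R := [seq x i 0 | i <- enum 'I_n].

Lemma colseq_castmx p q (e : p = q) (x : 'cV[R]_p) :
  colseq (castmx (e, erefl) x) = colseq x.
Proof. by case: q / e; rewrite castmx_id. Qed.

Lemma colseq_inj n : injective (@colseq n).
Proof.
move=> x y /eq_in_map xy; apply/colP => i; apply: xy.
by rewrite mem_enum.
Qed.

Lemma colseq_col_mx p q (x : 'cV[R]_p) (y : 'cV[R]_q) :
  colseq (col_mx x y) = colseq x ++ colseq y.
Proof.
have bigE n (z : 'cV[R]_n) : colseq z = \big[cat/[::]]_i [:: z i 0].
  rewrite /colseq enumT -[index_enum _]/(Finite.enum _).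
  elim: (Finite.enum _) => [|i s IH]; first by rewrite big_nil.
  by rewrite big_cons /= IH.
rewrite !bigE big_split_ord; congr (_ ++ _);
  by apply: eq_bigr => i _; rewrite ?col_mxEu ?col_mxEd.
Qed.

Lemma colseq_mxcol s (p : 'I_s -> nat) (v : forall i, 'cV[R]_(p i)) :
  colseq (\mxcol_i v i) = \big[cat/[::]]_i colseq (v i).
Proof.
elim: s p v => [|s IH] p v.
  rewrite [RHS]big_ord0 /colseq; apply/nilP; rewrite /nilp size_map size_enum_ord.
  by rewrite big_ord0.
by rewrite mxcol_recu colseq_castmx colseq_col_mx IH big_ord_recl.
Qed.

(** Both sides list the entries of [v 1], ..., [v k] in this order and differ only in where the
    stack is cut. [Xtilde] acts on the grouping of the right-hand side, while [Ubar2] delivers that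
    of the left-hand side. *)
Lemma castmx_hidden (m : nat -> nat) k (hk : (2 <= k)%N)
    (v : forall i, 'cV[R]_(m i)) :
  castmx (esym (hidden_dimE m hk), erefl)
    (col_mx (\mxcol_(i < k.-1) v i.+1 : 'cV[R]_(adim m k)) (v k)) =
  col_mx (v 1%N) (\mxcol_(i < k.-1) v i.+2).
Proof.
apply: colseq_inj; rewrite colseq_castmx !colseq_col_mx (colseq_mxcol (fun i => v i.+2)).
rewrite [colseq (\mxcol_ _ _)](colseq_mxcol (fun i : 'I_k.-1 => v i.+1)).
case: k hk => [//|[//|k]] _ /=.
by rewrite big_ord_recl [in RHS]big_ord_recr /= catA.
Qed.
End dot.

(** * Sector bounds of the layers and the quadratic form of the LMI *)

(** With [Q1], [Q2] the two [Qlayer] matrices, the expression factors as the inner product of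
    [w i.+1 - Q1 *m w i] and [w i.+1 - Q2 *m w i], which is the sum over the neurons of the scalar
    sector products. *)
Lemma network_sector_dot (R : realType) (m : nat -> nat)
    (W : forall i, 'M[R]_(m i.+1, m i)) (b : forall i, 'cV[R]_(m i.+1))
    (D : set 'cV[R]_(m 0%N)) (k : nat) (alpha beta : forall i, 'rV[R]_(m i.+1))
    (x y : 'cV[R]_(m 0%N)) i :
  network_incr_sector W b D k alpha beta -> (i < k)%N -> D x -> D y ->
  forall w : forall j, 'cV[R]_(m j),
  (forall j, w j = layer W b j x - layer W b j y) ->
  dot (w i.+1) (w i.+1) - dot ((Qlayer alpha W i + Qlayer beta W i) *m w i) (w i.+1)
  + dot (Qlayer alpha W i *m w i) (Qlayer beta W i *m w i) <= 0.
Proof.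
move=> sec ik Dx Dy w wE.
suff : dot (w i.+1 - Qlayer alpha W i *m w i)
           (w i.+1 - Qlayer beta W i *m w i) <= 0.
  rewrite mulmxDl !(dotDl, dotDr, dotNl, dotNr) [dot (w i.+1) (_ *m _)]dotC.
  by lra.
rewrite dotE sumr_le0// => j _.
have preactB : preact W b i x - preact W b i y = W i *m w i.
  by rewrite wE mulmxBr /preact opprD addrACA subrr addr0.
have Qw (K : forall i, 'rV[R]_(m i.+1)) :
    (Qlayer K W i *m w i) j 0
    = K i 0 j * (preact W b i x j 0 - preact W b i y j 0).
  rewrite /Qlayer -mulmxA mul_diag_mx -preactB [LHS]mxE.
  by congr (_ * _); rewrite !mxE.
have := sec i j ik _ _ (ex_intro2 _ _ x Dx erefl) (ex_intro2 _ _ y Dy erefl).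
rewrite -!Qw.
have subE (p q : 'cV[R]_(m i.+1)) : (p - q) j 0 = p j 0 - q j 0 by rewrite !mxE.
have layerSE z : layer W b i.+1 z j 0 = tanh (preact W b i z j 0) by rewrite mxE.
by rewrite !subE [in X in _ -> X]wE subE !layerSE.
Qed.

Lemma mul_castmx (R : realType) p q r (e : p = q) (M : 'M[R]_(r, p))
    (v : 'cV[R]_q) :
  castmx (erefl, e) M *m v = M *m castmx (esym e, erefl) v.
Proof. by case: q / e v => v; rewrite !castmx_id. Qed.

(** Both sides sum [f] over 1, ..., k. Splitting off the first term instead of the last leaves the
    squares of layers 2, ..., k, each to be paired with the sector terms of its layer. *)
Lemma sum_shift (V : nmodType) (f : nat -> V) k : (2 <= k)%N ->
  \sum_(i < k.-1) f i.+1 + f k = f 1%N + \sum_(i < k.-1) f i.+2.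
Proof.
case: k => [//|[//|k]] _ /=.
by rewrite big_ord_recl [in RHS]big_ord_recr /= addrA.
Qed.

(* The network differences [v i] enter the quadratic form of the LMI as the
   vector stacking [v 1, ..., v k]; [xi] and [e] fill the first two blocks. *)
Lemma LMI_qform (R : realType) (k l : nat) (m : nat -> nat)
    (hk : (2 <= k)%N) (A : 'M[R]_(m 0%N)) (g : 'M[R]_(m 0%N, l))
    (W : forall i, 'M[R]_(m i.+1, m i)) (Wmin : 'M[R]_(m 0%N, m k))
    (alpha beta : forall i, 'rV[R]_(m i.+1)) (slow lambda mu : R)
    (S : 'M[R]_(m 0%N)) (Y : 'M[R]_(l, m 0%N))
    (xi e : 'cV[R]_(m 0%N)) (v : forall i, 'cV[R]_(m i)) : S^T = S ->
  let Q i := Qlayer alpha W i + Qlayer beta W i in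
  qform ((Ubar1 R m k)^T
           *m block33 (- mu%:M) S                                0
                      S         ((A *m S + g *m Y)^T + A *m S + g *m Y) Wmin
                      0         Wmin^T                           0
           *m Ubar1 R m k
         + (Ubar2 R m k)^T
           *m block33 0 0                              0
                      0 (Xbar k slow lambda S alpha beta W) (Xtilde hk S alpha beta W)
                      0 (Xtilde hk S alpha beta W)^T   (- 2%:M)
           *m Ubar2 R m k)
    (col_mx xi (col_mx e (col_mx (\mxcol_(i < k.-1) v i.+1 : 'cV[R]_(adim m k)) (v k))))
  = - mu * dot xi xi + 2 * dot xi (S *m e)
  + 2 * dot e ((A *m S + g *m Y) *m e) + 2 * dot e (Wmin *m v k)
  - 2 * slow * lambda * dot e (S *m e) + 2 * dot (Q 0 *m (S *m e)) (v 1%N)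
  - 2 * dot (v 1%N) (v 1%N)
  - 2 * \sum_(i < k.-1)
     (dot (v i.+2) (v i.+2) - dot (Q i.+1 *m v i.+1) (v i.+2)
      + dot (Qlayer alpha W i.+1 *m v i.+1) (Qlayer beta W i.+1 *m v i.+1)).
Proof.
move=> symS Q.
rewrite qformD !qform_conj mul_Ubar1 mul_Ubar2 !qform_block33.
set eta : 'cV[R]_(adim m k) := \mxcol_ _ _.
rewrite !mul0mx !dot0r !(add0r, addr0).
have QaE K : Qa k K W *m eta = \mxcol_(i < k.-1) (Qlayer K W i.+1 *m v i.+1).
  exact: mulmx_blockdiag_mxcol.
have stack : castmx (esym (hidden_dimE m hk), erefl) (col_mx eta (v k))
    = col_mx (v 1%N) (\mxcol_(i < k.-1) v i.+2).
  exact: castmx_hidden.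
have XtE : dot (col_mx e eta) (Xtilde hk S alpha beta W *m col_mx eta (v k))
    = dot (Q 0 *m (S *m e)) (v 1%N)
      + \sum_(i < k.-1) dot (Q i.+1 *m v i.+1) (v i.+2).
  rewrite /Xtilde mul_castmx stack mul_block_col !mul0mx addr0 add0r dot_col_mx.
  rewrite -mulmxA dot_mulmxr symS dot_mulmxr trmxK; congr (_ + _).
  rewrite dot_mulmxr trmxK mulmxDl !QaE -mxcolD.
  by under eq_mxcol do rewrite -mulmxDl; rewrite dot_mxcol.
rewrite [dot _ ((Xtilde _ _ _ _ _)^T *m _)]dot_mulmxr trmxK [dot (_ *m _) _]dotC XtE.
rewrite /Xbar mul_block_col !mul0mx addr0 add0r dot_col_mx.
rewrite !mulNmx !mul_scalar_mx -!scalemxAl !(dotZr, dotNr).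
rewrite dot_col_mx [dot eta eta]dot_mxcol.
rewrite (sum_shift (fun i => dot (v i) (v i)) hk) -mulmxA.
rewrite [dot eta _]dot_mulmxr trmxK !QaE dot_mxcol.
rewrite [dot e (S *m xi)]dot_mulmxr symS [dot (S *m e) xi]dotC.
rewrite [dot (v k) _]dot_mulmxr trmxK [dot (Wmin *m _) _]dotC.
rewrite !big_split /= sumrN.
have symE (M : 'M[R]_(m 0%N)) : dot e ((M^T + M) *m e) = 2 * dot e (M *m e).
  rewrite mulmxDl dotDr [dot e (M^T *m e)]dot_mulmxr trmxK [dot (_ *m e) e]dotC.
  by ring.
rewrite -[_^T + _ + _]addrA symE.
ring.
Qed.

(** * Continuity of bilinear forms and minima on the Euclidean sphere *)

Section topology.
Variable R : realType.

(** Convergence is asked for coordinatewise so that the lemma serves both transposed row vectors and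
    trajectories. *)
Lemma cvg_dot_mulmx (T : Type) (F : set_system T) (FF : Filter F) p q
    (M : 'M[R]_(p, q)) (x : T -> 'cV[R]_p) (y : T -> 'cV[R]_q)
    (a : 'cV[R]_p) (c : 'cV[R]_q) :
  (forall i, x t i 0 @[t --> F] --> a i 0) ->
  (forall i, y t i 0 @[t --> F] --> c i 0) ->
  dot (x t) (M *m y t) @[t --> F] --> dot a (M *m c).
Proof.
move=> xa yc; rewrite dotE; under eq_fun do rewrite dotE.
apply: cvg_big; [exact: add_continuous|] => i _; apply: cvgM; first exact: xa.
rewrite mxE; under eq_fun do rewrite mxE.
apply: cvg_big; [exact: add_continuous|] => j _; apply: cvgM; last exact: yc.
exact: cvg_cst.
Qed.

(** The maximum norm is attained at some entry, whose square is one of the summands on the right. *)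
Lemma mx_norm_sqr_le_dot n (x : 'rV[R]_n) : `|x| ^+ 2 <= dot x^T x^T.
Proof.
have [->|x0] := eqVneq `|x| 0; first by rewrite expr0n dot_ge0.
have [[i j] /= ] := mx_norm_neq0 x0; rewrite -[mx_norm x]/`|x| ord1 => ->.
rewrite real_normK ?num_real// expr2 dotE (bigD1 j)//= !mxE lerDl sumr_ge0// => k _.
by rewrite -expr2 sqr_ge0.
Qed.

(** The Euclidean unit sphere, in row vectors because [bounded_closed_compact] is stated for
    these. *)
Definition rsphere n : set 'rV[R]_n := [set v | dot v^T v^T = 1].

Lemma cvg_trmx_coord n (v : 'rV[R]_n) i : w^T i 0 @[w --> v] --> v^T i 0.
Proof.
rewrite mxE; under eq_fun do rewrite mxE.
exact: coord_continuous.
Qed.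

Lemma continuous_dot_mulmx_tr n (M : 'M[R]_n) :
  continuous (fun v : 'rV[R]_n => dot v^T (M *m v^T)).
Proof.
by move=> v; apply: (cvg_dot_mulmx (nbhs_filter v)) => i; exact: cvg_trmx_coord.
Qed.

Lemma compact_rsphere n : compact (@rsphere n).
Proof.
apply: bounded_closed_compact.
  exists 1; split=> // r r1 v /= v1; rewrite (le_trans _ (ltW r1))//.
  by rewrite -(@expr_le1 _ 2)// -v1 mx_norm_sqr_le_dot.
rewrite [@rsphere n](_ : _ = (fun v : 'rV[R]_n => dot v^T (1%:M *m v^T)) @^-1` [set 1]).
  by apply: preimage_closed; [move=> v _|exact: closed_eq];
    exact: continuous_dot_mulmx_tr.
by apply/seteqP; split => v /=; rewrite mul1mx.
Qed.

(** The vector [x0], once normalized, shows that the sphere is nonempty; this excludes dimension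
    0. *)
Lemma sphere_min n (f : 'cV[R]_n -> R) (x0 : 'cV[R]_n) :
  continuous (fun v : 'rV[R]_n => f v^T) -> x0 != 0 ->
  exists2 v, dot v v = 1 & forall w, dot w w = 1 -> f v <= f w.
Proof.
move=> cf x0_neq0.
have [|v + vmin] := compact_EVT_min _ (@compact_rsphere n) (continuous_subspaceT cf).
  exists ((Num.sqrt (dot x0 x0))^-1 *: x0^T); rewrite /rsphere /= linearZ /= trmxK.
  rewrite dotZl dotZr mulrA -invfM -expr2 sqr_sqrtr ?dot_ge0// mulVf//.
  by rewrite dot_eq0.
rewrite inE => v1; exists v^T => // w w1; rewrite -[w]trmxK; apply: vmin.
by rewrite inE /rsphere /= trmxK.
Qed.
End topology.

(** * The minimum eigenvalue as a lower bound of the Rayleigh quotient *)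

Section rayleigh.
Variable R : realType.

(** Along [v + t *: w] with [w = B *m v], the form is a polynomial in [t] without constant term and
    with linear coefficient [2 * dot w w]. It would be negative for small negative [t] unless
    [w = 0]. *)
Lemma psd_kernel n (B : 'M[R]_n) v : B^T = B ->
  (forall x, 0 <= dot x (B *m x)) -> dot v (B *m v) = 0 -> B *m v = 0.
Proof.
move=> symB psd v0; apply/eqP; rewrite -dot_eq0; apply/eqP.
set w := B *m v; set q := dot w (B *m w).
have h t : 0 <= 2 * t * dot w w + t ^+ 2 * q.
  have := psd (v + t *: w).
  rewrite mulmxDr -scalemxAr !(dotDr, dotDl, dotZl, dotZr) v0 -/w.
  rewrite [dot v (B *m w)]dot_mulmxr symB -/w -/q.
  by congr (_ <= _); ring.
have q0 : 0 <= q by exact: psd.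
have := dot_ge0 w; rewrite le_eqVlt => /predU1P[<-//|ww].
have q1 : 0 < q + 1 by lra.
(* Adding 1 keeps the denominator positive when [q = 0]. *)
have := h (- (dot w w) / (q + 1)).
rewrite (_ : _ + _ = - ((dot w w / (q + 1)) ^+ 2 * (q + 2))); last first.
  by field; rewrite gt_eqF.
by rewrite oppr_ge0 leNgt mulr_gt0// ?exprn_gt0 ?divr_gt0// ltr_wpDl.
Qed.

(** The minimum [nu] of the form on the sphere is an eigenvalue: [M - nu%:M] is positive
    semidefinite and its form vanishes at the minimizer, which thus lies in the kernel. Hence
    [lambda <= nu]. *)
Lemma min_eigenvalue_le n (M : 'M[R]_n) lambda x : M^T = M ->
  is_min_eigenvalue M lambda -> lambda * dot x x <= dot x (M *m x).
Proof.
move=> symM [_ lmin].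
have [->|x0] := eqVneq x 0; first by rewrite mulmx0 !dot0r mulr0.
have [v v1 vmin] := @sphere_min _ _ (fun v => dot v (M *m v)) _
  (@continuous_dot_mulmx_tr R n M) x0.
set nu := dot v (M *m v) in vmin.
have nule y : nu * dot y y <= dot y (M *m y).
  have [->|y0] := eqVneq y 0; first by rewrite mulmx0 !dot0r mulr0.
  have yy : 0 < dot y y by rewrite dot_gt0.
  have := vmin ((Num.sqrt (dot y y))^-1 *: y).
  rewrite -scalemxAr !(dotZl, dotZr) !mulrA -invfM -expr2 sqr_sqrtr ?dot_ge0//.
  by rewrite mulVf ?gt_eqF// ler_pdivlMl// mulrC; exact.
have Mv : M *m v = nu *: v.
  apply/eqP; rewrite -subr_eq0 -mul_scalar_mx -mulmxBl; apply/eqP.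
  apply: psd_kernel => [|y|].
  - by rewrite linearB /= symM tr_scalar_mx.
  - by rewrite mulmxBl mul_scalar_mx dotDr dotNr dotZr subr_ge0.
  - by rewrite mulmxBl mul_scalar_mx dotDr dotNr dotZr v1 mulr1 subrr.
apply: le_trans (nule x); rewrite ler_wpM2r ?dot_ge0//; apply: lmin.
(* [eigenvalue] refers to row eigenvectors, so the symmetry of [M] is used to transpose. *)
apply/eigenvalueP; exists v^T.
  by rewrite -{1}symM -trmx_mul Mv linearZ.
by rewrite trmx_eq0 -dot_gt0 v1 ltr01.
Qed.
End rayleigh.

(** * Equivalence of an arbitrary norm with the Euclidean one *)

Section norms.
Variables (R : realType) (n : nat) (N : 'cV[R]_n -> R).
Hypothesis hN : is_norm N.

Lemma is_norm0 : N 0 = 0.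
Proof. by rewrite -(scale0r 0) (is_norm_scale hN) normr0 mul0r. Qed.

Lemma is_normN x : N (- x) = N x.
Proof. by rewrite -scaleN1r (is_norm_scale hN) normrN1 mul1r. Qed.

Lemma is_norm_ge0 x : 0 <= N x.
Proof.
have := is_norm_triangle hN x (- x).
by rewrite subrr is_norm0 is_normN -mulr2n pmulrn_lge0.
Qed.

Lemma is_norm_sum (I : Type) (r : seq I) (F : I -> 'cV[R]_n) :
  N (\sum_(i <- r) F i) <= \sum_(i <- r) N (F i).
Proof.
elim/big_rec2: _ => [|i y x _ xy]; first by rewrite is_norm0.
by rewrite (le_trans (is_norm_triangle hN _ _))// lerD2l.
Qed.

(** A Lipschitz constant of [N] for the maximum norm, read off from the expansion in the standard
    basis. *)
Definition norm_bound : R := \sum_i N (delta_mx i 0).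

Lemma norm_bound_ge0 : 0 <= norm_bound.
Proof. by rewrite sumr_ge0// => i _; exact: is_norm_ge0. Qed.

Lemma is_norm_le_mx_norm (x : 'rV[R]_n) : N x^T <= norm_bound * `|x|.
Proof.
rewrite {1}[x^T]matrix_sum_delta /norm_bound mulr_suml.
under eq_bigr do rewrite big_ord1.
rewrite (le_trans (is_norm_sum _ _))// ler_sum// => i _.
rewrite (is_norm_scale hN) mulrC ler_wpM2l ?is_norm_ge0// mxE.
rewrite [leRHS]/Num.norm/= mx_normrE.
exact: (le_bigmax _ (fun ij => `|x ij.1 ij.2|) (0, i)).
Qed.

Lemma is_norm_continuous : continuous (fun v : 'rV[R]_n => N v^T).
Proof.
move=> v; apply/(@cvgrPdist_le _ _ _ _ (nbhs_filter v)) => /= e e0.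
(* Adding 1 makes the radius [e / (norm_bound + 1)] positive even if [norm_bound] vanishes. *)
have K0 : 0 < norm_bound + 1 by rewrite ltr_wpDl// norm_bound_ge0.
near=> w.
have vw : `|v - w| <= e / (norm_bound + 1).
  near: w; apply/nbhs_ballP; exists (e / (norm_bound + 1)) => /=.
    by rewrite divr_gt0.
  by move=> w; rewrite mx_norm_ball /ball_ /= => /ltW.
have dist_le a c : N a^T - N c^T <= norm_bound * `|a - c|.
  rewrite lerBlDr (le_trans _ (lerD (is_norm_le_mx_norm _) (lexx _)))//.
  by rewrite (le_trans _ (is_norm_triangle hN _ _))// linearB /= subrK.
have le_e : norm_bound * `|v - w| <= e.
  move: vw; rewrite ler_pdivlMr// mulrC; apply: le_trans; rewrite ler_wpM2r//; lra.
rewrite ler_norml (le_trans (dist_le _ _))// andbT lerNl opprB.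
by rewrite (le_trans (dist_le _ _))// distrC.
Unshelve. all: by end_near. Qed.

Lemma is_norm_sqr_le : exists2 c, 0 < c & forall x, N x ^+ 2 <= c * dot x x.
Proof.
exists (norm_bound ^+ 2 + 1) => [|x]; first by rewrite ltr_wpDl// sqr_ge0.
have := is_norm_le_mx_norm x^T; rewrite trmxK => Nx.
have /le_trans -> // : N x ^+ 2 <= norm_bound ^+ 2 * `|x^T| ^+ 2.
  by rewrite -exprMn ler_sqr// ?nnegrE ?is_norm_ge0// mulr_ge0// norm_bound_ge0.
have := mx_norm_sqr_le_dot x^T; rewrite trmxK => xx.
rewrite mulrDl mul1r ler_wpDr ?dot_ge0// ler_wpM2l ?sqr_ge0//.
Qed.

(** By continuity [N] attains a minimum on the Euclidean sphere, which is positive by definiteness;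
    homogeneity extends the bound to all vectors. *)
Lemma dot_le_is_norm_sqr : exists2 c, 0 < c & forall x, dot x x <= c * N x ^+ 2.
Proof.
have [[x0 x0_neq0]|all0] := pselect (exists x0 : 'cV[R]_n, x0 != 0); last first.
  (* In dimension 0 the sphere is empty, but the only vector is 0 and any positive constant
     works. *)
  exists 1 => // x; have [->|x0] := eqVneq x 0; last by case: all0; exists x.
  by rewrite dot0r mul1r sqr_ge0.
have [v v1 vmin] := sphere_min is_norm_continuous x0_neq0.
have Nv : 0 < N v.
  rewrite lt_neqAle is_norm_ge0 andbT eq_sym; apply/eqP => /(is_norm_eq0 hN) v0.
  by move: v1; rewrite v0 dot0r => /esym/eqP; rewrite oner_eq0.
exists (N v ^- 2) => [|x]; first by rewrite invr_gt0 exprn_gt0.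
have [->|x_neq0] := eqVneq x 0.
  by rewrite dot0r mulr_ge0// ?invr_ge0 sqr_ge0.
have xx : 0 < dot x x by rewrite dot_gt0.
set s := Num.sqrt (dot x x).
have s0 : 0 < s by rewrite sqrtr_gt0.
have ssq : s ^+ 2 = dot x x by rewrite sqr_sqrtr ?dot_ge0.
have /vmin : dot (s^-1 *: x) (s^-1 *: x) = 1.
  by rewrite dotZl dotZr mulrA -invfM -expr2 ssq mulVf// gt_eqF.
rewrite (is_norm_scale hN) gtr0_norm ?invr_gt0// ler_pdivlMl// => sNv.
rewrite ler_pdivlMl ?exprn_gt0// -ssq mulrC -exprMn.
by rewrite ler_sqr// nnegrE ?is_norm_ge0// mulr_ge0// ltW.
Qed.

End norms.

(** * Gronwall's inequality and differentiation along trajectories *)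

Section decay.
Variable R : realType.

(** The product of [V] with [expR (rho * t)] has nonpositive derivative at positive times and is
    right-continuous at 0, hence never exceeds its initial value. The condition at 0 is one-sided
    because solutions are only constrained at nonnegative times. *)
Lemma gronwall_decay (V dV : R -> R) (rho : R) :
  V h @[h --> 0^'+] --> V 0 -> (forall t : R, 0 < t -> is_derive t 1 V (dV t)) ->
  (forall t : R, 0 < t -> dV t <= - rho * V t) ->
  forall t : R, 0 <= t -> V t <= expR (- rho * t) * V 0.
Proof.
move=> V0 derV dV_le t; rewrite le_eqVlt => /predU1P[<-|t0].
  by rewrite mulr0 expR0 mul1r.
pose E := expR \o (rho \*: @id R).
have derE (s : R) : is_derive s 1 E (expR (rho * s) * rho).
  have dlin : is_derive s 1 (rho \*: @id R) (rho *: 1) by exact: is_deriveZ.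
  have := is_derive1_comp (is_derive_expR _) dlin.
  by rewrite [rho *: 1]mulr1.
have derG (s : R) : 0 < s ->
    is_derive s 1 (E * V) (E s *: dV s + V s *: (expR (rho * s) * rho)).
  by move=> s0; have := derV _ s0 => ?; exact: is_deriveM.
have G_le : (E * V) t <= (E * V) 0.
  apply: (@ler0_derive1_le_cc R (E * V) 0 t); rewrite ?in_itv /= ?lexx ?ltW//.
  - move=> s; rewrite in_itv /= => /andP[s0 _].
    by have := derG _ s0 => ?; exact: ex_derive.
  - move=> s; rewrite in_itv /= => /andP[s0 _].
    rewrite derive1E (@derive_val _ _ _ _ _ _ _ (derG _ s0)).
    rewrite /E /= /GRing.scale /=.
    have := dV_le _ s0; rewrite -(ler_pM2l (expR_gt0 (rho * s))).
    lra.
  apply/continuous_within_itvP => //; split.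
  - move=> s; rewrite in_itv /= => /andP[s0 _].
    apply/differentiable_continuous/derivable1_diffP.
    by have := derG _ s0 => ?; exact: ex_derive.
  - apply: cvgM => //; apply: cvg_at_right_filter.
    by apply/differentiable_continuous/derivable1_diffP; exact: ex_derive.
  - apply: cvg_at_left_filter.
    apply/differentiable_continuous/derivable1_diffP.
    by have := derG _ t0 => ?; exact: ex_derive.
have GE s : (E * V) s = expR (rho * s) * V s by [].
move: G_le; rewrite !GE mulr0 expR0 mul1r mulNr expRN.
by rewrite ler_pdivlMl ?expR_gt0.
Qed.

(** For positive [h], [x h] is [x 0] plus [h] times the difference quotient, and the quotient has a
    limit. *)
Lemma is_solution_cvg0 n (f : 'cV[R]_n -> 'cV[R]_n) x : is_solution f x ->
  x h @[h --> 0^'+] --> x 0.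
Proof.
move=> [x0 _].
have : x 0 + h *: (h^-1 *: (x h - x 0)) @[h --> 0^'+] --> x 0 + 0 *: f (x 0).
  apply: cvgD; first exact: cvg_cst.
  by apply: cvgZ => //; apply: cvg_at_right_filter; exact: cvg_id.
rewrite scale0r addr0; apply: cvg_trans; apply: near_eq_cvg.
near=> h; have h0 : 0 < h by near: h; exact: nbhs_right_gt.
by rewrite scalerA mulfV ?gt_eqF// scale1r addrC subrK.
Unshelve. all: by end_near. Qed.

Lemma is_derive_mx_coord p q (x : R -> 'M[R]_(p, q)) (t v : R) df i j :
  is_derive t v x df -> is_derive t v (fun s => x s i j) (df i j).
Proof.
move=> dx; apply: DeriveDef.
  by move/derivable_mxP : (@ex_derive _ _ _ _ _ _ _ dx) => /(_ i j).
by rewrite -(@derive_val _ _ _ _ _ _ _ dx) derive_mx ?mxE//; exact: ex_derive.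
Qed.

Lemma is_derive_dot_mulmx p q (M : 'M[R]_(p, q)) (x : R -> 'cV[R]_p)
    (y : R -> 'cV[R]_q) (t : R) dx dy :
  is_derive t 1 x dx -> is_derive t 1 y dy ->
  is_derive t 1 (fun s => dot (x s) (M *m y s))
    (dot (x t) (M *m dy) + dot dx (M *m y t)).
Proof.
move=> derx dery.
have derxi i := is_derive_mx_coord i 0 derx.
have deryi i := is_derive_mx_coord i 0 dery.
(* Written as a sum of products of scalar functions, the form is differentiated by the scalar
   rules. *)
have -> : (fun s => dot (x s) (M *m y s)) =
    \sum_i (fun s => x s i 0) * (\sum_j M i j \*: (fun s => y s j 0)).
  apply/funext => s; rewrite dotE fct_sumE; apply: eq_bigr => i _.
  by rewrite mxE [RHS]/(_ * _) /= fct_sumE.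
have derMy i : is_derive t (1 : R) (\sum_j M i j \*: (fun s => y s j 0))
    (\sum_j M i j *: dy j 0).
  by apply: is_derive_sum => j; apply: is_deriveZ; exact: deryi.
have derprod i := is_deriveM (derxi i) (derMy i).
have D := is_derive_sum derprod.
apply: (is_derive_eq D).
rewrite !dotE -big_split; apply: eq_bigr => i _ /=.
rewrite fct_sumE !mxE /GRing.scale /=; congr (_ + _).
by rewrite mulrC.
Qed.
End decay.

(** * Bounds on the inverse of a positive definite matrix *)

Section posdef.
Variables (R : realType) (n : nat) (S : 'M[R]_n).
Hypothesis hS : posdefmx S.

Lemma posdefmx_unitmx : S \in unitmx.
Proof.
rewrite unitmxE unitfE; apply/det0P => -[v v0 vS0].
have := hS.2 v^T; rewrite trmx_eq0 v0 qformE => /(_ isT).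
by rewrite -hS.1 -trmx_mul vS0 trmx0 dot0r ltxx.
Qed.

Lemma posdefmx_mulV (x : 'cV[R]_n) : S *m (invmx S *m x) = x.
Proof. by rewrite mulKVmx// posdefmx_unitmx. Qed.

(* With [B = S - a] and [x = S y], the difference of the two sides is
   [|B y|^2 + a y^T B y]. *)
Lemma dot_invmx_le a (x : 'cV[R]_n) : 0 <= a -> mxle a%:M S ->
  a * dot x (invmx S *m x) <= dot x x.
Proof.
move=> a0 aS; rewrite -{1 3 4}(posdefmx_mulV x); set y := invmx S *m x.
have := aS y; rewrite qformE mulmxBl mul_scalar_mx dotDr dotNr dotZr => yB.
have := dot_ge0 (S *m y - a *: y).
rewrite !(dotDr, dotDl, dotNl, dotNr, dotZr, dotZl) [dot y (S *m y)]dotC.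
rewrite [dot y (S *m y)]dotC in yB.
nra.
Qed.

(* The quadratic form of [S] is nonnegative at [S^-1 x - h^-1 x]. *)
Lemma dot_le_invmx h (x : 'cV[R]_n) : 0 < h -> mxle S h%:M ->
  dot x x <= h * dot x (invmx S *m x).
Proof.
move=> h0 Sh; set y := invmx S *m x.
have Sy : S *m y = x by exact: posdefmx_mulV.
have qS z : 0 <= dot z (S *m z).
  have [->|z0] := eqVneq z 0; first by rewrite mulmx0 dot0r.
  by rewrite -qformE ltW// hS.2.
have := qS (y - h^-1 *: x).
rewrite mulmxBr -scalemxAr !(dotDr, dotDl, dotNl, dotNr, dotZr, dotZl) Sy.
rewrite [dot y (S *m x)]dot_mulmxr hS.1 Sy [dot y x]dotC.
have := Sh x; rewrite qformE mulmxBl mul_scalar_mx dotDr dotNr dotZr subr_le0.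
move=> Shx qS0.
have u0 : 0 < h^-1 by rewrite invr_gt0.
have hu : h^-1 * h = 1 by rewrite mulVf// gt_eqF.
rewrite -(ler_pM2l u0) mulrA hu mul1r.
have : h^-1 * (h^-1 * dot x (S *m x)) <= h^-1 * dot x x.
  by rewrite ler_pM2l// -(ler_pM2l h0) mulrA [h / h]mulrC hu mul1r.
lra.
Qed.
End posdef.

(** * The matrix of the first layer and the sign of its minimum eigenvalue *)

Section first_layer.
Variables (R : realType) (m : nat -> nat) (W : forall i, 'M[R]_(m i.+1, m i)).
Variables (alpha beta : forall i, 'rV[R]_(m i.+1)) (i : nat).

(** Diagonal matrices commute. Symmetry is what [min_eigenvalue_le] requires. *)
Lemma Qlayer_tr_mul_sym :
  ((Qlayer alpha W i)^T *m Qlayer beta W i)^T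
  = (Qlayer alpha W i)^T *m Qlayer beta W i.
Proof.
rewrite /Qlayer !trmx_mul !trmxK !tr_diag_mx -!mulmxA; congr (_ *m _).
by rewrite !mulmxA diag_mxC.
Qed.

(** With [u = W i *m x], the form is the sum of [alpha i 0 j * beta i 0 j * u j 0 ^+ 2]. *)
Lemma Qlayer_tr_mul_psd x :
  (forall j, 0 <= alpha i 0 j) -> (forall j, alpha i 0 j <= beta i 0 j) ->
  0 <= dot x ((Qlayer alpha W i)^T *m Qlayer beta W i *m x).
Proof.
move=> a0 ab; rewrite -mulmxA dot_mulmxr trmxK dotE sumr_ge0// => j _.
rewrite /Qlayer -!mulmxA !mul_diag_mx; move: (W i *m x) => u.
rewrite [(\matrix_(_, _) _) j 0]mxE [X in _ * X]mxE mulrACA -[u j 0 * _]expr2.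
by rewrite mulr_ge0 ?sqr_ge0// mulr_ge0// (le_trans (a0 j)).
Qed.

(** At an eigenvector [v] the form equals [lambda] times the squared length of [v]. The sign allows
    inequalities to be multiplied by [lambda]. *)
Lemma min_eigenvalue_Qlayer_ge0 lambda :
  (forall j, 0 <= alpha i 0 j) -> (forall j, alpha i 0 j <= beta i 0 j) ->
  is_min_eigenvalue ((Qlayer alpha W i)^T *m Qlayer beta W i) lambda ->
  0 <= lambda.
Proof.
move=> a0 ab [/eigenvalueP[v vM v0] _].
have := Qlayer_tr_mul_psd v^T a0 ab.
rewrite -Qlayer_tr_mul_sym -trmx_mul vM linearZ /= dotZr pmulr_lge0//.
by rewrite dot_gt0 trmx_eq0.
Qed.
End first_layer.

(** * Differences of the closed-loop vector field *)

Section closed_loop.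
Variables (R : realType) (k l : nat) (m : nat -> nat).
Variables (A : 'M[R]_(m 0%N)) (g : 'M[R]_(m 0%N, l)).
Variables (W : forall i, 'M[R]_(m i.+1, m i)) (b : forall i, 'cV[R]_(m i.+1)).
Variables (Wout : 'M[R]_(m 0%N, m k)) (bout : 'cV[R]_(m 0%N)).
Variables (Wu : 'M[R]_(l, m k)) (bu : 'cV[R]_l).
Variables (S : 'M[R]_(m 0%N)) (Y : 'M[R]_(l, m 0%N)).

(** The biases cancel, and with [H = Y *m invmx S] the linear part satisfies [A + g *m H = (A *m S +
    g *m Y) *m invmx S]. *)
Lemma closed_loopB x y : S \in unitmx ->
  let f := learned_affine_system A g W b Wout bout
             (nn_controller W b (Y *m invmx S) Wu bu) in
  f x - f y = (A *m S + g *m Y) *m (invmx S *m (x - y))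
            + (Wout + g *m Wu) *m (layer W b k x - layer W b k y).
Proof.
move=> Su /=; rewrite /learned_affine_system /nn_controller.
have -> : (A *m S + g *m Y) *m (invmx S *m (x - y))
    = A *m x - A *m y + (g *m (Y *m invmx S *m x) - g *m (Y *m invmx S *m y)).
  by rewrite mulmxDl -!mulmxA mulKVmx// !mulmxBr.
rewrite [X in _ = _ + X]mulmxDl !mulmxBr !mulmxDr -!mulmxA.
move: (A *m x) (A *m y) (g *m _) (g *m _) (Wout *m _) (Wout *m _) => a1 a2 p1 p2.
move: (g *m _) (g *m _) (g *m _) => q1 q2 q3 r1 r2.
by apply/colP => i; rewrite !mxE; ring.
Qed.
End closed_loop.

(** * Dissipation inequality and exponential estimate *)

Theorem mainTheorem8 (R : realType) (k l : nat) (m : nat -> nat)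
    (hk : (2 <= k)%N)
    (A : 'M[R]_(m 0%N)) (g : 'M[R]_(m 0%N, l))
    (W : forall i, 'M[R]_(m i.+1, m i)) (b : forall i, 'cV[R]_(m i.+1))
    (Wout : 'M[R]_(m 0%N, m k)) (bout : 'cV[R]_(m 0%N))
    (D : set 'cV[R]_(m 0%N))
    (alpha beta : forall i, 'rV[R]_(m i.+1))
    (halpha : forall i (j : 'I_(m i.+1)), (i < k)%N -> 0 <= alpha i 0 j)
    (hbeta : forall i (j : 'I_(m i.+1)), (i < k)%N -> alpha i 0 j <= beta i 0 j)
    (hsector : network_incr_sector W b D k alpha beta)
    (Nin : 'cV[R]_(m k) -> R) (Nout : 'cV[R]_(m 0%N) -> R)
    (hNin : is_norm Nin) (hNout : is_norm Nout)
    (Wu : 'M[R]_(l, m k))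
    (hWu : is_argmin
      (fun V : 'M[R]_(l, m k) => induced_norm Nin Nout (Wout + g *m V)) Wu)
    (bu : 'cV[R]_l)
    (slow lambda : R) (hslow : 0 < slow)
    (hlambda : is_min_eigenvalue
      ((Qlayer alpha W 0%N)^T *m Qlayer beta W 0%N) lambda)
    (S : 'M[R]_(m 0%N)) (mu shigh : R) (Y : 'M[R]_(l, m 0%N))
    (hS : posdefmx S) (hmu : 0 < mu) (hshigh : 0 < shigh)
    (hSlow : mxle slow%:M S) (hShigh : mxle S shigh%:M)
    (hLMI : let Wmin := Wout + g *m Wu in
      mxle
        ((Ubar1 R m k)^T
           *m block33 (- mu%:M) S                                0
                      S         ((A *m S + g *m Y)^T + A *m S + g *m Y) Wmin
                      0         Wmin^T                           0
           *m Ubar1 R m k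
         + (Ubar2 R m k)^T
           *m block33 0 0                              0
                      0 (Xbar k slow lambda S alpha beta W) (Xtilde hk S alpha beta W)
                      0 (Xtilde hk S alpha beta W)^T   (- 2%:M)
           *m Ubar2 R m k)
        0)
    (N : 'cV[R]_(m 0%N) -> R) (hN : is_norm N)
    (C : set 'cV[R]_(m 0%N)) (hCD : C `<=` D) :
  let f := learned_affine_system A g W b Wout bout
             (nn_controller W b (Y *m invmx S) Wu bu) in
  forward_complete_invariant f C -> contractive N f C.
Proof.
move=> f fwd.
have [symS _] := hS.
have Su := posdefmx_unitmx hS.
set P := invmx S.
have symP : P^T = P by rewrite /P trmx_inv symS.
have k0 : (0 < k)%N := ltnW hk.
have lambda0 : 0 <= lambda.
  apply: min_eigenvalue_Qlayer_ge0 hlambda => j; first exact: halpha.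
  exact: hbeta.
have slowle := dot_invmx_le hS _ (ltW hslow) hSlow.
have lehigh := dot_le_invmx hS _ hshigh hShigh.
(* An inequality between states, free of trajectories; its left side becomes the derivative of [V]
   along two solutions. *)
have dissipation x y : D x -> D y ->
    2 * dot (x - y) (P *m (f x - f y)) <= - mu^-1 * dot (x - y) (x - y).
  move=> Dx Dy; set d := x - y; set e := P *m d.
  pose v i := layer W b i x - layer W b i y.
  have vE i : v i = layer W b i x - layer W b i y by [].
  have sec i (ik : (i < k)%N) := network_sector_dot hsector ik Dx Dy vE.
  have Se : S *m e = d by exact: posdefmx_mulV.
  (* The first block [mu^-1 *: d] maximizes [- mu * dot xi xi + 2 * dot xi d] over [xi], with value
     [mu^-1 * dot d d]. The second block [e] satisfies [S *m e = d], which turns [A *m S + g *m Y]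
     into the closed-loop matrix. *)
  have := hLMI (col_mx (mu^-1 *: d) (col_mx e
    (col_mx (\mxcol_(i < k.-1) v i.+1 : 'cV[R]_(adim m k)) (v k)))).
  rewrite subr0 LMI_qform// Se !dotZl !dotZr.
  have sum_le0 : \sum_(i < k.-1)
     (dot (v i.+2) (v i.+2)
      - dot ((Qlayer alpha W i.+1 + Qlayer beta W i.+1) *m v i.+1) (v i.+2)
      + dot (Qlayer alpha W i.+1 *m v i.+1) (Qlayer beta W i.+1 *m v i.+1)) <= 0.
    by apply: sumr_le0 => i _; apply: sec; rewrite -ltn_predRL.
  have v0 : v 0%N = d by [].
  have := sec _ k0; rewrite v0.
  have := min_eigenvalue_le d (Qlayer_tr_mul_sym W alpha beta 0) hlambda.
  rewrite -mulmxA dot_mulmxr trmxK.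
  have := ler_wpM2l lambda0 (slowle d); rewrite -/P -/e.
  rewrite [dot d (P *m _)]dot_mulmxr symP -/e.
  rewrite [f x - f y]closed_loopB// -/P -/d -/e -/(v k).
  rewrite [dot e (_ *m _ + _)]dotDr [dot d e]dotC.
  have -> : - mu * (mu^-1 * (mu^-1 * dot d d)) = - (mu^-1 * dot d d).
    by field; rewrite gt_eqF.
  rewrite mulNr.
  move: sum_le0; set Sg := \sum_(i < k.-1) _.
  move=> sum_le0 le1 le2 le3 le4.
  (* The LMI holds the left side where the sector inequality of the first layer has the right side;
     the two are compared through [lambda * dot d d]. *)
  have : 2 * slow * lambda * dot e d
      <= 2 * dot (Qlayer alpha W 0 *m d) (Qlayer beta W 0 *m d).
    by move: (le_trans le1 le2); lra.
  by lra.
(* Decay rate of [V]: dissipation gives [- mu^-1 * dot d d], and [slow * V] is at most [dot d d]. *)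
pose rho := slow / mu.
have rho0 : 0 < rho by rewrite divr_gt0.
have [c1 c1_gt0 Nle] := is_norm_sqr_le hN.
have [c2 c2_gt0 leN] := dot_le_is_norm_sqr hN.
(* The factors pass from [N] squared to the Euclidean square, then to [V] at time [t], and at time 0
   back from [V] to the Euclidean square and to [N] squared. *)
pose c := c1 * shigh / slow * c2.
have c_gt0 : 0 < c by rewrite !mulr_gt0// invr_gt0.
(* [V] is comparable to the square of [N], hence the square root and the halved rate. *)
exists (Num.sqrt c), (rho / 2); split; [by rewrite sqrtr_gt0|by rewrite divr_gt0|].
move=> x1 x2 sol1 sol2 C1 C2.
(* Forward invariance keeps both solutions in [C], hence in [D], where the sector bounds hold. *)
have inC x : is_solution f x -> C (x 0) -> forall t : R, 0 <= t -> D (x t).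
  by move=> sol Cx t t0; apply: hCD; apply: (fwd _ Cx).2 sol erefl t t0.
pose V t := dot (x1 t - x2 t) (P *m (x1 t - x2 t)).
pose dV t := dot (x1 t - x2 t) (P *m (f (x1 t) - f (x2 t))) +
             dot (f (x1 t) - f (x2 t)) (P *m (x1 t - x2 t)).
have V0 : V h @[h --> 0^'+] --> V 0.
  have cvg0 i : (x1 t - x2 t) i 0 @[t --> 0^'+] --> (x1 0 - x2 0) i 0.
    apply: (@cvg_comp _ _ _ (fun t => x1 t - x2 t) (fun M : 'cV[R]_(m 0%N) => M i 0)).
      by apply: cvgB; [exact: is_solution_cvg0 sol1|exact: is_solution_cvg0 sol2].
    exact: coord_continuous.
  exact: cvg_dot_mulmx.
have derV (t : R) : 0 < t -> is_derive t 1 V (dV t).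
  move=> t0; have := is_deriveB (sol1.2 _ t0) (sol2.2 _ t0) => der.
  exact: is_derive_dot_mulmx.
have dV_le (t : R) : 0 < t -> dV t <= - rho * V t.
  move=> t0.
  have := dissipation _ _ (inC _ sol1 C1 t (ltW t0)) (inC _ sol2 C2 t (ltW t0)).
  rewrite /dV [dot _ (P *m (x1 t - x2 t))]dot_mulmxr symP [dot (P *m _) _]dotC.
  rewrite -mulr2n mulr_natl => /le_trans; apply.
  rewrite /rho !mulNr lerN2 mulrAC mulrC ler_pM2l ?invr_gt0//.
  exact: slowle.
move=> t t0.
have decay := gronwall_decay V0 derV dV_le t0.
have N1 x := is_norm_ge0 hN x.
rewrite -ler_sqr ?nnegrE ?N1 ?mulr_ge0 ?expR_ge0 ?sqrtr_ge0 ?N1//.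
rewrite !exprMn sqr_sqrtr ?(ltW c_gt0)// -expRM_natl.
rewrite (_ : 2 * _ = - rho * t); last by move: (rho) => r; field.
have E0 : 0 <= expR (- rho * t) by exact: expR_ge0.
move: (expR _) E0 decay => E E0 decay.
apply: le_trans (Nle _) _.
rewrite /c -!mulrA ler_pM2l//.
apply: le_trans (lehigh _) _; rewrite ler_pM2l//.
apply: le_trans decay _.
rewrite ler_pdivlMl// [leRHS]mulrCA [leLHS](mulrCA slow) (ler_wpM2l E0)//.
exact: le_trans (slowle _) (leN _).
Qed.
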